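(* For each integer $n\ge 1$, the Tutte polynomial $T_n(x,y)=T(G_n;x,y)$ of the Farey graph $G_n$ is given by $$T_n(x,y)=T_{1,n}(x,y)+(x-1)N_n(x,y),$$ where the polynomials $T_{1,n}=T_{1,n}(x,y)$ and $N_n=N_n(x,y)$ satisfy the recursive relations $$T_{1,n}= y\,T_{1,n-1}^2 +2\,T_{1,n-1}N_{n-1}+(x-1)N_{n-1}^2,$$ $$N_{n}=2\,T_{1,n-1}N_{n-1}+(x-1)N_{n-1}^2,$$ with initial conditions $T_{1,0}(x,y)=1$ and $N_0(x,y)=1$.
   Context: Farey graphs. The Farey graphs $G_n$ ($n\ge 0$), each with two distinguished (''special'') vertices $X_n,Y_n$, are defined recursively. $G_0$ is a single edge joining its two special vertices $X_0$ and $Y_0$. For $n\ge 1$, take two disjoint copies $G_{n-1}^1,G_{n-1}^2$ of $G_{n-1}$, with special vertices $X_{n-1}^i,Y_{n-1}^i$ ($i=1,2$); identify $Y_{n-1}^1$ with $X_{n-1}^2$ into one vertex, and add a new edge $e_n$ joining $X_{n-1}^1$ and $Y_{n-1}^2$. The result is $G_n$, with special vertices $X_n=X_{n-1}^1$ and $Y_n=Y_{n-1}^2$. It has $2^n+1$ vertices and $2^{n+1}-1$ edges. Tutte polynomial. A spanning subgraph $H$ of a graph $G$ is a subgraph with $V(H)=V(G)$ and $E(H)\subseteq E(G)$. With $k(H)$ the number of connected components of $H$, the rank is $r(H)=|V(H)|-k(H)$ and the nullity is $n(H)=|E(H)|-r(H)$. The Tutte polynomial is $$T(G;x,y)=\sum_{H}(x-1)^{r(G)-r(H)}(y-1)^{n(H)},$$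 the sum being over all spanning subgraphs $H$ of $G$. Partial sums. Let $G_{1,n}$ be the set of spanning subgraphs of $G_n$ in which $X_n$ and $Y_n$ belong to the same connected component, and $G_{2,n}$ the set of spanning subgraphs of $G_n$ in which $X_n$ and $Y_n$ belong to two different connected components. For $i=1,2$ and $n\ge0$ define $$T_{i,n}(x,y)=\sum_{H\in G_{i,n}}(x-1)^{r(G_n)-r(H)}(y-1)^{n(H)}.$$ For every $n\ge 0$ the polynomial $T_{2,n}$ is divisible by $x-1$, and $N_n(x,y)\in\mathbb{Z}[x,y]$ denotes the quotient, i.e. $T_{2,n}(x,y)=(x-1)N_n(x,y)$. *)

(* Defs.v *)
From mathcomp Require Import all_boot all_order all_algebra.
From mathcomp Require Import mpoly.

Set Implicit Arguments.
Unset Strict Implicit.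
Unset Printing Implicit Defensive.

Import GRing.Theory.
Local Open Scope ring_scope.

(* Finite undirected graphs, with named edges. The order of the two endpoints
   in [ends e] is irrelevant: see [adj]. *)
Record graph := Graph {
  vert : finType;
  edge : finType;
  ends : edge -> vert * vert
}.

(* A spanning subgraph has all the vertices of [G], so it is given by its set
   of edges [H : {set edge G}]; [G] itself is [setT]. *)
Definition adj (G : graph) (H : {set edge G}) : rel (vert G) :=
  [rel u v | [exists e in H, (ends e == (u, v)) || (ends e == (v, u))]].

Definition same_comp (G : graph) (H : {set edge G}) (u v : vert G) : bool :=
  connect (adj H) u v.

Definition ncomp (G : graph) (H : {set edge G}) : nat :=
  n_comp (adj H) (vert G).

(* No subtraction is truncated here or in [tutte_term]:
   ncomp H <= #|vert G|, rank H <= #|H| and rank H <= rank G. *)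
Definition rank (G : graph) (H : {set edge G}) : nat := (#|vert G| - ncomp H)%N.

Definition nullity (G : graph) (H : {set edge G}) : nat := (#|H| - rank H)%N.

Definition x : {mpoly int[2]} := 'X_(ord0 : 'I_2).
Definition y : {mpoly int[2]} := 'X_(ord_max : 'I_2).

Definition tutte_term (G : graph) (H : {set edge G}) : {mpoly int[2]} :=
  (x - 1) ^+ (rank [set: edge G] - rank H) * (y - 1) ^+ nullity H.

Definition tutte (G : graph) : {mpoly int[2]} :=
  \sum_(H : {set edge G}) tutte_term H.

Record stgraph := STGraph {
  st_graph :> graph;
  specX : vert st_graph;
  specY : vert st_graph
}.

Definition edge_graph : stgraph :=
  @STGraph (@Graph bool unit (fun=> (false, true))) false true.

Section Glue.
Variables G1 G2 : stgraph.

(* The disjoint union of the vertices with [specY G1] and [specX G2]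
   identified: the merged vertex is represented by [inl (specY G1)]. *)
Definition glue_vert : finType :=
  (vert G1 + {v : vert G2 | v != specX G2})%type.

Definition glue1 (v : vert G1) : glue_vert := inl v.

Definition glue2 (v : vert G2) : glue_vert :=
  if insub v is Some w then inr w else inl (specY G1).

(* [None] is the new edge. *)
Definition glue_edge : finType := option (edge G1 + edge G2).

Definition glue_ends (e : glue_edge) : glue_vert * glue_vert :=
  match e with
  | None => (glue1 (specX G1), glue2 (specY G2))
  | Some (inl e1) => (glue1 (ends e1).1, glue1 (ends e1).2)
  | Some (inr e2) => (glue2 (ends e2).1, glue2 (ends e2).2)
  end.

Definition glue : stgraph :=
  @STGraph (Graph glue_ends) (glue1 (specX G1)) (glue2 (specY G2)).

End Glue.

Fixpoint farey (n : nat) : stgraph :=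
  if n is m.+1 then glue (farey m) (farey m) else edge_graph.

Definition T1 (n : nat) : {mpoly int[2]} :=
  \sum_(H : {set edge (farey n)} | same_comp H (specX (farey n)) (specY (farey n)))
    tutte_term H.

Definition T2 (n : nat) : {mpoly int[2]} :=
  \sum_(H : {set edge (farey n)} | ~~ same_comp H (specX (farey n)) (specY (farey n)))
    tutte_term H.

Lemma card_farey_vert n : #|vert (farey n)| = (2 ^ n + 1)%N.
Proof.
elim: n => [|n IHn] /=; first by rewrite card_bool.
rewrite card_sum card_sig IHn.
have -> : #|[pred v | v != specX (farey n)]| = (2 ^ n)%N.
  have := cardC1 (specX (farey n)); rewrite IHn addn1 => /= <-.
  by apply: eq_card => v; rewrite !inE.
by rewrite expnS mul2n -addnn addnAC.
Qed.

Lemma card_farey_edge n : #|edge (farey n)| = (2 ^ n.+1 - 1)%N.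
Proof.
elim: n => [|n IHn] /=; first by rewrite card_unit.
rewrite card_option card_sum IHn [in RHS]expnS mul2n -addnn.
have : (0 < 2 ^ n.+1)%N by rewrite expn_gt0.
by case: (2 ^ n.+1)%N => // k _; rewrite !subn1 /= addnS.
Qed.

Lemma adj_sym (G : graph) (H : {set edge G}) : ssrbool.symmetric (adj H).
Proof. by move=> u v; apply: eq_existsb => e /=; rewrite orbC. Qed.

Lemma adjS (G : graph) (H K : {set edge G}) :
  H \subset K -> subrel (adj H) (adj K).
Proof.
move=> sHK u v /existsP[e /andP[eH uve]]; apply/existsP; exists e.
by rewrite (subsetP sHK).
Qed.

Lemma ncomp_le_card (G : graph) (H : {set edge G}) : (ncomp H <= #|vert G|)%N.
Proof. exact: max_card. Qed.

Lemma ncomp_lt (G : graph) (H K : {set edge G}) (u v : vert G) :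
  H \subset K -> ~~ same_comp H u v -> same_comp K u v ->
  (ncomp K < ncomp H)%N.
Proof.
move=> sHK nHuv Kuv.
have symH := sym_connect_sym (@adj_sym _ H).
have symK := sym_connect_sym (@adj_sym _ K).
have sub w z : connect (adj H) w z -> connect (adj K) w z.
  by apply: connect_sub => a b /(adjS sHK)/connect1.
have rootKH w : fingraph.root (adj K) (fingraph.root (adj H) w) = fingraph.root (adj K) w.
  by apply/eqP; rewrite root_connect // symK; apply/sub/connect_root.
have rrH := root_root symH.
pose R (L : {set edge G}) := [set w | fingraph.root (adj L) w == w].
have cE (L : {set edge G}) : ncomp L = #|R L|.
  by rewrite /ncomp /n_comp_mem; apply: eq_card => w; rewrite !inE andbT.
have sub2 : R K \subset
    fingraph.root (adj K) @: (R H :\ fingraph.root (adj H) u).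
  apply/subsetP => w; rewrite inE => /eqP rw; apply/imsetP.
  have [Eu|neq] := eqVneq (fingraph.root (adj H) w) (fingraph.root (adj H) u).
    exists (fingraph.root (adj H) v).
      by rewrite !inE rrH eqxx andbT root_connect // symH.
    rewrite rootKH -rw -(rootKH w) Eu rootKH.
    by apply/eqP; rewrite root_connect.
  exists (fingraph.root (adj H) w); last by rewrite rootKH rw.
  by rewrite !inE neq rrH eqxx.
rewrite !cE [ltnRHS](cardsD1 (fingraph.root (adj H) u)) inE rrH eqxx ltnS.
exact: leq_trans (subset_leq_card sub2) (leq_imset_card _ _).
Qed.

Lemma farey_special_adj n : adj [set: edge (farey n)] (specX (farey n)) (specY (farey n)).
Proof.
by case: n => [|n]; apply/existsP; [exists tt | exists None]; rewrite !inE eqxx.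
Qed.

Lemma T2_divisible n : exists N : {mpoly int[2]}, T2 n == (x - 1) * N.
Proof.
exists (\sum_(H | ~~ same_comp H (specX (farey n)) (specY (farey n)))
  (x - 1) ^+ (rank [set: edge (farey n)] - rank H).-1 * (y - 1) ^+ nullity H).
rewrite /T2 mulr_sumr; apply/eqP/eq_bigr => H nH.
rewrite /tutte_term mulrA -exprS prednK // subn_gt0 /rank ltn_sub2l //.
  apply: leq_trans (ncomp_le_card H); apply: ncomp_lt nH _; first exact: subsetT.
  exact/connect1/farey_special_adj.
apply: ncomp_lt nH _; first exact: subsetT.
exact/connect1/farey_special_adj.
Qed.

(* The quotient of [T2 n] by [x - 1], unique since {mpoly int[2]} is an
   integral domain. *)
Definition N (n : nat) : {mpoly int[2]} := xchoose (T2_divisible n).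

Lemma T2E n : T2 n = (x - 1) * N n.
Proof. exact/eqP/(xchooseP (T2_divisible n)). Qed.

(* Main.v *)
(* A spanning subgraph of G_n is a pair (A, B) of spanning subgraphs of the two
   copies of G_(n-1), with or without the new edge e_n.
   - Without e_n, the two copies meet in a cut vertex, so corank and nullity add.
   - With e_n, if A and B both join their special vertices, then e_n closes a
     cycle: the nullity grows by 1, whence a factor y - 1.
   - With e_n, otherwise, e_n merges two components: the corank drops by 1, and
     the term is the product of those of A and B divided by x - 1.
   Summing over A and B gives the two recursions multiplied by x - 1. *)
Require Import Defs.
From mathcomp Require Import all_boot all_order all_algebra.
From mathcomp Require Import mpoly.
From mathcomp Require Import ring zify.
Import GRing.Theory.
Local Open Scope ring_scope.

Set Implicit Arguments.
Unset Strict Implicit.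
Unset Printing Implicit Defensive.

(** * Generic tools: transport of connectivity, induction on finite sets *)

Lemma connect_hom (T T' : finType) (e : rel T) (e' : rel T') (f : T -> T') :
  (forall u v, e u v -> connect e' (f u) (f v)) ->
  forall u v, connect e u v -> connect e' (f u) (f v).
Proof.
move=> hom u v /connectP[p]; elim: p u => [|w p IHp] u /= => [_ ->|] //.
by case/andP=> /hom euw /IHp /[apply]; apply: connect_trans.
Qed.

Lemma set_ind (T : finType) (P : {set T} -> Prop) :
  P set0 -> (forall a (A : {set T}), a \notin A -> P A -> P (a |: A)) -> forall A, P A.
Proof.
move=> P0 PU A; have [n] := ubnP #|A|; elim: n A => // n IHn A.
have [->//|[a aA]] := set_0Vmem A; rewrite (cardsD1 a) aA ltnS => ltAn.
by rewrite -(setD1K aA); apply: PU (IHn _ ltAn); rewrite !inE eqxx.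
Qed.

(** * Components of a spanning subgraph, edge by edge *)

Section Components.
Variable G : graph.
Implicit Types (H K : {set edge G}) (e : edge G) (u v : vert G).

Lemma same_compxx H u : same_comp H u u.
Proof. exact: connect0. Qed.

Lemma same_comp_trans H : transitive (same_comp H).
Proof. exact: connect_trans. Qed.

Lemma same_compS H K u v : H \subset K -> same_comp H u v -> same_comp K u v.
Proof. by move=> sHK; apply: connect_sub => a b /(adjS sHK)/connect1. Qed.

Lemma same_comp_ends H e : e \in H -> same_comp H (ends e).1 (ends e).2.
Proof.
move=> eH; apply/connect1/existsP; exists e.
by rewrite eH -surjective_pairing eqxx.
Qed.

Lemma same_comp_hom (T : finType) (r : rel T) (f : vert G -> T) H :
  ssrbool.symmetric r ->
  (forall e, e \in H -> connect r (f (ends e).1) (f (ends e).2)) ->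
  forall u v, same_comp H u v -> connect r (f u) (f v).
Proof.
move=> sym_r hom; apply: connect_hom => u v /existsP[e /andP[eH uve]].
have := hom e eH.
by case/orP: uve => /eqP -> //=; rewrite (sym_connect_sym sym_r).
Qed.

(** Serves to refute connectivity: a function that no edge of [H] changes cannot separate two
    vertices of one component. *)
Lemma same_comp_inv (T : Type) (f : vert G -> T) H :
  (forall e, e \in H -> f (ends e).1 = f (ends e).2) ->
  forall u v, same_comp H u v -> f u = f v.
Proof.
move=> inv u _ /connectP[p + ->]; elim: p u => //= w p IHp u.
case/andP=> /existsP[e /andP[eH uwe]] /IHp <-.
by have := inv e eH; case/orP: uwe => /eqP ->.
Qed.

Lemma ncompE H : ncomp H = #|[set u | fingraph.root (adj H) u == u]|.
Proof. by apply: eq_card => u; rewrite !inE andbT. Qed.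

Lemma ncomp0 : ncomp (set0 : {set edge G}) = #|vert G|.
Proof.
rewrite ncompE -cardsT; congr #|pred_of_set _|; apply/setP=> u; rewrite !inE.
apply/eqP; case/connectP: (connect_root (adj set0) u) => -[_ ->|v p /andP[]] //=.
by case/existsP=> e; rewrite inE.
Qed.

(** An edge either closes a cycle or merges exactly two components. With [set_ind], this reduces
    every later component count to an induction on edges; the additive form avoids truncated
    subtraction. *)
Lemma ncompU1 H e :
  ncomp H = (ncomp (e |: H) + ~~ same_comp H (ends e).1 (ends e).2)%N.
Proof.
set a := (ends e).1; set b := (ends e).2.
have symH := sym_connect_sym (@adj_sym _ H).
have symK := sym_connect_sym (@adj_sym _ (e |: H)).
have sHK : H \subset e |: H by apply: subsetUr.
have Kab : same_comp (e |: H) a b by apply/same_comp_ends/setU11.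
case: (boolP (same_comp H a b)) => [Hab|nHab] /=.
  rewrite addn0; apply: eq_n_comp => u v; apply/idP/idP.
    exact: same_compS.
  apply: (@same_comp_hom _ (adj H) id) => [|e']; first exact: adj_sym.
  by case/setU1P=> [->//|]; apply: same_comp_ends.
(* [ncomp_lt] gives the strict drop; what remains is that at most one component is lost. *)
apply/eqP; rewrite eqn_leq addn1 (ncomp_lt sHK nHab Kab) andbT.
pose f u := if same_comp H u b then fingraph.root (adj H) a
            else fingraph.root (adj H) u.
(* [f] collapses the class of [b] in [H] onto that of [a], so it is constant on
   the classes of [e |: H]. *)
have fK u v : same_comp (e |: H) u v -> f u = f v.
  apply: same_comp_inv => e' /setU1P[->|/same_comp_ends eH].
    by rewrite -/a -/b /f same_compxx (negPf nHab).
  rewrite /f /same_comp (same_connect symH eH); case: ifP => // _.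
  by apply/eqP; rewrite root_connect.
rewrite !ncompE (cardsD1 (fingraph.root (adj H) b)) inE (root_root symH).
rewrite eqxx add1n ltnS.
(* Taking roots in [e |: H] is injective on the roots of [H] other than that of [b], because [f] is
   constant on the classes of [e |: H] and fixes those roots. *)
rewrite -(@card_in_imset _ _ (fingraph.root (adj (e |: H)))).
  apply/subset_leq_card/subsetP => _ /imsetP[u _ ->].
  by rewrite inE root_root.
have fR u : u \in [set u | fingraph.root (adj H) u == u] :\ fingraph.root (adj H) b ->
    f u = u.
  rewrite !inE /f => /andP[nub /eqP ru]; case: ifP => // ub.
  by case/eqP: nub; rewrite -ru; apply/eqP; rewrite root_connect.
move=> u v uR vR /eqP; rewrite root_connect // => /fK.
by rewrite !fR.
Qed.

Lemma vert_le_ncomp H : (#|vert G| <= ncomp H + #|H|)%N.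
Proof.
elim/set_ind: H => [|e H eH]; first by rewrite ncomp0 leq_addr.
by rewrite cardsU1 eH (ncompU1 H e); case: same_comp => /=; lia.
Qed.

Lemma ncompS H K : H \subset K -> (ncomp K <= ncomp H)%N.
Proof.
(* [K] is rewritten as [H :|: K], so that its edges can be added to [H] one at a time. *)
move=> /setUidPr <-; elim/set_ind: K => [|e K _]; first by rewrite setU0.
by rewrite setUCA (ncompU1 (H :|: K) e); lia.
Qed.

(** The vertex count cancels in the corank, so both exponents depend on [H] only through [ncomp H]
    and [#|H|], the quantities that gluing controls. *)
Lemma tutte_termE H :
  tutte_term H = (x - 1) ^+ (ncomp H - ncomp [set: edge G])
                 * (y - 1) ^+ (ncomp H + #|H| - #|vert G|).
Proof.
rewrite /tutte_term /nullity /rank.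
have := vert_le_ncomp H; have := ncompS (subsetT H); have := ncomp_le_card H.
by move=> *; congr (_ ^+ _ * _ ^+ _); lia.
Qed.

End Components.

(** Stated for any graph with two special vertices, so that gluing can be studied for two unrelated
    graphs; at [farey n], [S1] and [S2] are [T1 n] and [T2 n] by conversion. *)
Definition S1 (G : stgraph) : {mpoly int[2]} :=
  \sum_(H : {set edge G} | same_comp H (specX G) (specY G)) tutte_term H.

Definition S2 (G : stgraph) : {mpoly int[2]} :=
  \sum_(H : {set edge G} | ~~ same_comp H (specX G) (specY G)) tutte_term H.

Lemma S1E G :
  S1 G = \sum_H if same_comp H (specX G) (specY G) then tutte_term H else 0.
Proof. exact: big_mkcond. Qed.

Lemma S2E G :
  S2 G = \sum_H if same_comp H (specX G) (specY G) then 0 else tutte_term H.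
Proof. by rewrite /S2 big_mkcond; apply: eq_bigr => H _; rewrite if_neg. Qed.

(** * Spanning subgraphs and connectivity of a glued graph *)

Section Glue.
Variables G1 G2 : stgraph.
Local Notation G := (glue G1 G2).
Implicit Types (A : {set edge G1}) (B : {set edge G2}).

Definition glue_set (b : bool) A B : {set edge G} :=
  [set e : option (edge G1 + edge G2) | match e with
                | None => b
                | Some (inl e1) => e1 \in A
                | Some (inr e2) => e2 \in B
                end].

Lemma glue_set_bij :
  bijective (fun t : bool * ({set edge G1} * {set edge G2}) =>
               glue_set t.1 t.2.1 t.2.2).
Proof.
exists (fun H : {set edge G} => ((None : edge G) \in H,
  ([set e1 | (Some (inl e1) : edge G) \in H], [set e2 | (Some (inr e2) : edge G) \in H]))).
  by case=> b [A B] /=; rewrite inE; congr (_, (_, _)); apply/setP=> e; rewrite !inE.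
by move=> H; apply/setP => -[[e|e]|]; rewrite !inE.
Qed.

Lemma big_glue_set (R : nmodType) (F : {set edge G} -> R) :
  \sum_H F H = \sum_A \sum_B (F (glue_set true A B) + F (glue_set false A B)).
Proof.
rewrite (reindex _ (onW_bij _ glue_set_bij)) /= -(pair_bigA _ (fun b p =>
  F (glue_set b p.1 p.2))) big_bool -big_split /=.
by rewrite (pair_bigA _ (fun A B => F (glue_set true A B) + F (glue_set false A B))).
Qed.

Lemma glue_set0 : glue_set false set0 set0 = set0.
Proof. by apply/setP => -[[e|e]|]; rewrite !inE. Qed.

Lemma glue_setT : glue_set true setT setT = setT.
Proof. by apply/setP => -[[e|e]|]; rewrite !inE. Qed.

Lemma glue_set_new A B : glue_set true A B = (None : edge G) |: glue_set false A B.
Proof. by apply/setP => -[[e|e]|]; rewrite !inE. Qed.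

Lemma glue_setU1l b e A B :
  glue_set b (e |: A) B = (Some (inl e) : edge G) |: glue_set b A B.
Proof. by apply/setP => -[[e'|e']|]; rewrite !inE. Qed.

Lemma glue_setU1r b e A B :
  glue_set b A (e |: B) = (Some (inr e) : edge G) |: glue_set b A B.
Proof. by apply/setP => -[[e'|e']|]; rewrite !inE. Qed.

Lemma card_glue_set b A B : #|glue_set b A B| = (b + (#|A| + #|B|))%N.
Proof.
elim/set_ind: A => [|e A eA IH]; last first.
  by rewrite glue_setU1l !cardsU1 inE IH eA; lia.
elim/set_ind: B => [|e B eB IH]; last first.
  by rewrite glue_setU1r cardsU1 inE IH cardsU1 eB; lia.
by case: b; rewrite ?glue_set_new ?cardsU1 ?inE glue_set0 !cards0.
Qed.

Lemma glue2_specX : glue2 G1 (specX G2) = glue1 G2 (specY G1) :> vert G.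
Proof. by rewrite /glue2 insubF ?eqxx. Qed.

(* Without the new edge, connectivity in the glued graph is computed by the two
   retractions that collapse one copy onto the merged vertex. *)
Definition retract1 (w : vert G) : vert G1 := if w is inl v then v else specY G1.

Definition retract2 (w : vert G) : vert G2 :=
  if w is inr v then val v else specX G2.

Lemma retract1_glue2 v : retract1 (glue2 G1 v) = specY G1.
Proof. by rewrite /glue2; case: insub. Qed.

Lemma retract2_glue2 v : retract2 (glue2 G1 v) = v.
Proof. by rewrite /glue2; case: insubP => [u _ <- //|/negPn/eqP ->]. Qed.

Lemma same_comp_retract1 A B u v :
  same_comp (glue_set false A B) u v -> same_comp A (retract1 u) (retract1 v).
Proof.
apply: same_comp_hom => [|[[e|e]|]]; first exact: adj_sym.
- by rewrite inE => eA; apply: same_comp_ends.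
- by rewrite inE /= !retract1_glue2 => _; apply: connect0.
- by rewrite inE.
Qed.

Lemma same_comp_retract2 A B u v :
  same_comp (glue_set false A B) u v -> same_comp B (retract2 u) (retract2 v).
Proof.
apply: same_comp_hom => [|[[e|e]|]]; first exact: adj_sym.
- by rewrite inE => _; apply: connect0.
- by rewrite inE /= !retract2_glue2 => eB; apply: same_comp_ends.
- by rewrite inE.
Qed.

Lemma same_comp_glue1 A B u v :
  same_comp (glue_set false A B) (glue1 G2 u) (glue1 G2 v) = same_comp A u v.
Proof.
apply/idP/idP => [/same_comp_retract1 //|].
apply: same_comp_hom => [|e eA]; first exact: adj_sym.
have eG : (Some (inl e) : edge G) \in glue_set false A B by rewrite inE.
exact: same_comp_ends eG.
Qed.

Lemma same_comp_glue2 A B u v :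
  same_comp (glue_set false A B) (glue2 G1 u) (glue2 G1 v) = same_comp B u v.
Proof.
apply/idP/idP => [/same_comp_retract2|]; first by rewrite !retract2_glue2.
apply: same_comp_hom => [|e eA]; first exact: adj_sym.
have eG : (Some (inr e) : edge G) \in glue_set false A B by rewrite inE.
exact: same_comp_ends eG.
Qed.

(** Collapsing either copy onto the merged vertex turns a walk between the outer special vertices
    into a walk across the other copy; conversely, walks across the two copies meet at the merged
    vertex. *)
Lemma same_comp_glue A B :
  same_comp (glue_set false A B) (specX G) (specY G)
  = same_comp A (specX G1) (specY G1) && same_comp B (specX G2) (specY G2).
Proof.
apply/idP/andP => [XY|[XY1 XY2]].
  split; first by have := same_comp_retract1 XY; rewrite /= retract1_glue2.
  by have := same_comp_retract2 XY; rewrite /= retract2_glue2.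
apply: (@same_comp_trans G _ (glue1 G2 (specY G1))); first by rewrite same_comp_glue1.
by rewrite -glue2_specX same_comp_glue2.
Qed.

(** * Component counts, Tutte terms and partial sums under gluing *)

Lemma card_glue_vert : (#|vert G| + 1 = #|vert G1| + #|vert G2|)%N.
Proof.
rewrite card_sum card_sig.
have := cardC1 (specX G2).
have -> : #|predC1 (specX G2)| = #|[pred v | v != specX G2]|.
  by apply: eq_card => v; rewrite !inE.
have : (0 < #|vert G2|)%N by apply/card_gt0P; exists (specX G2).
by move=> + ->; lia.
Qed.

(** Adding an edge to [A] or [B] changes both sides equally, since its ends are joined in the glued
    graph exactly when they are joined in their own copy. With no edges left, this is the vertex
    count. *)
Lemma ncomp_glue A B :
  (ncomp (glue_set false A B) + 1 = ncomp A + ncomp B)%N.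
Proof.
elim/set_ind: A => [|e A _]; last first.
  rewrite glue_setU1l (ncompU1 A e).
  rewrite (ncompU1 (glue_set false A B) (Some (inl e))) /= same_comp_glue1.
  by lia.
elim/set_ind: B => [|e B _]; last first.
  rewrite glue_setU1r (ncompU1 B e).
  rewrite (ncompU1 (glue_set false set0 B) (Some (inr e))) /= same_comp_glue2.
  by lia.
by rewrite glue_set0 !ncomp0 card_glue_vert.
Qed.

Lemma ncomp_glue_new A B :
  (ncomp (glue_set true A B) + 1
     + ~~ (same_comp A (specX G1) (specY G1) && same_comp B (specX G2) (specY G2))
   = ncomp A + ncomp B)%N.
Proof.
have := ncompU1 (glue_set false A B) None.
rewrite -glue_set_new same_comp_glue -ncomp_glue; lia.
Qed.

Lemma same_comp_glue_new A B : same_comp (glue_set true A B) (specX G) (specY G).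
Proof.
have eG : (None : edge G) \in glue_set true A B by rewrite inE.
exact: same_comp_ends eG.
Qed.

Hypotheses (full1 : same_comp setT (specX G1) (specY G1))
           (full2 : same_comp setT (specX G2) (specY G2)).

(** In the whole graph the new edge closes a cycle, as each copy already joins its special vertices;
    hence the reference rank in the corank is additive. *)
Lemma ncomp_glue_full :
  (ncomp [set: edge G] + 1 = ncomp [set: edge G1] + ncomp [set: edge G2])%N.
Proof.
rewrite -glue_setT.
by have := ncomp_glue_new setT setT; rewrite full1 full2 addn0.
Qed.

Lemma tutte_term_glue A B :
  tutte_term (glue_set false A B) = tutte_term A * tutte_term B.
Proof.
rewrite !tutte_termE mulrACA -!exprD card_glue_set.
(* The equalities match the exponents; the inequalities below ensure that no subtraction in them is
   truncated. *)
have := ncomp_glue A B; have := ncomp_glue_full; have := card_glue_vert.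
have := vert_le_ncomp A; have := vert_le_ncomp B.
have := ncompS (subsetT A); have := ncompS (subsetT B).
by move=> *; congr (_ ^+ _ * _ ^+ _); lia.
Qed.

Lemma tutte_term_glue_new A B :
  same_comp A (specX G1) (specY G1) && same_comp B (specX G2) (specY G2) ->
  tutte_term (glue_set true A B) = (y - 1) * (tutte_term A * tutte_term B).
Proof.
move=> XY; have := ncomp_glue_new A B; rewrite XY.
rewrite !tutte_termE mulrACA -!exprD mulrCA -exprS card_glue_set.
have := ncomp_glue_full; have := card_glue_vert.
have := vert_le_ncomp A; have := vert_le_ncomp B.
have := ncompS (subsetT A); have := ncompS (subsetT B).
by move=> *; congr (_ ^+ _ * _ ^+ _); lia.
Qed.

Lemma tutte_term_glue_bridge A B :
  ~~ (same_comp A (specX G1) (specY G1) && same_comp B (specX G2) (specY G2)) ->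
  (x - 1) * tutte_term (glue_set true A B) = tutte_term A * tutte_term B.
Proof.
move=> XY; have := ncomp_glue_new A B; rewrite XY.
(* Makes the corank with the new edge a true difference, so that the extra factor [x - 1] raises it
   by exactly one. *)
have := ncompS (subsetT (glue_set true A B)).
rewrite !tutte_termE mulrACA -!exprD mulrA -exprS card_glue_set.
have := ncomp_glue_full; have := card_glue_vert.
have := vert_le_ncomp A; have := vert_le_ncomp B.
have := ncompS (subsetT A); have := ncompS (subsetT B).
by move=> *; congr (_ ^+ _ * _ ^+ _); lia.
Qed.

(** The new edge joins the special vertices, so only sets without it contribute: the pairs in which
    at least one copy is not joined. *)
Lemma S2_glue : S2 G = S1 G1 * S2 G2 + S2 G1 * S1 G2 + S2 G1 * S2 G2.
Proof.
rewrite !S1E !S2E big_glue_set.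
rewrite !big_distrlr -!big_split /=; apply: eq_bigr => A _.
rewrite -!big_split; apply: eq_bigr => B _ /=.
rewrite same_comp_glue_new same_comp_glue tutte_term_glue.
by do 2?case: same_comp; rewrite /=; ring.
Qed.

(** A pair joined in both copies counts once without the new edge and [y - 1] times with it, whence
    the factor [y]. Every other pair enters only with the new edge, and the factor [x - 1] on the
    left clears its division. *)
Lemma S1_glue :
  (x - 1) * S1 G = (x - 1) * y * (S1 G1 * S1 G2)
                   + S1 G1 * S2 G2 + S2 G1 * S1 G2 + S2 G1 * S2 G2.
Proof.
rewrite !S1E !S2E big_glue_set.
rewrite !big_distrlr !mulr_sumr -!big_split /=; apply: eq_bigr => A _.
rewrite !mulr_sumr -!big_split; apply: eq_bigr => B _ /=.
rewrite same_comp_glue_new same_comp_glue tutte_term_glue mulrDr.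
case: (boolP (_ && _)) => [XY|nXY].
  by rewrite tutte_term_glue_new //; case/andP: XY => -> ->; ring.
rewrite tutte_term_glue_bridge //; move: nXY.
by case: same_comp; case: same_comp => //= _; ring.
Qed.

End Glue.

(** * Cancelling [x - 1], the one-edge graph, and the Farey recursion *)

Lemma subx1_neq0 : x - 1 != 0.
Proof.
(* Evaluation at the origin sends [x - 1] to [-1]. *)
apply: contraTneq isT => /(congr1 (meval (fun=> 0))).
by rewrite mevalB mevalXU meval0 meval1.
Qed.

Lemma tutte_split (G : stgraph) : tutte G = S1 G + S2 G.
Proof. exact: bigID. Qed.

Lemma edge_graph_set (H : {set edge edge_graph}) : H = set0 \/ H = setT.
Proof.
case: (set_0Vmem H) => [|[[] eH]]; [by left | right].
by apply/setP => -[]; rewrite inE eH.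
Qed.

Lemma same_comp_edge_graph0 : same_comp (set0 : {set edge edge_graph}) false true = false.
Proof.
apply/negP => con; suff: false = true by [].
by apply: (same_comp_inv (f := id) _ con) => e; rewrite inE.
Qed.

Lemma same_comp_edge_graphT : same_comp [set: edge edge_graph] false true.
Proof. exact: connect1 (farey_special_adj 0). Qed.

Lemma ncomp_edge_graphT : ncomp [set: edge edge_graph] = 1%N.
Proof.
have := ncompU1 (set0 : {set edge edge_graph}) tt.
have -> : tt |: set0 = [set: edge edge_graph] by apply/setP => -[]; rewrite !inE.
by rewrite ncomp0 card_bool same_comp_edge_graph0 addn1 => -[].
Qed.

Lemma S1_edge_graph : S1 edge_graph = 1.
Proof.
rewrite /S1 (big_pred1 setT) => [|H /=].
  by rewrite tutte_termE ncomp_edge_graphT cardsT card_unit card_bool mulr1.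
case: (edge_graph_set H) => ->; last by rewrite eqxx same_comp_edge_graphT.
by rewrite same_comp_edge_graph0; apply/esym/eqP => /setP/(_ tt); rewrite !inE.
Qed.

Lemma S2_edge_graph : S2 edge_graph = x - 1.
Proof.
rewrite /S2 (big_pred1 set0) => [|H /=].
  by rewrite tutte_termE ncomp_edge_graphT ncomp0 cards0 card_bool mulr1.
case: (edge_graph_set H) => ->; first by rewrite eqxx same_comp_edge_graph0.
by rewrite same_comp_edge_graphT; apply/esym/eqP => /setP/(_ tt); rewrite !inE.
Qed.

Theorem corollary3 :
  [/\ T1 0 = 1,
      N 0 = 1
    & forall n : nat, (1 <= n)%N ->
      [/\ tutte (farey n) = T1 n + (x - 1) * N n,
          T1 n = y * T1 n.-1 ^+ 2 + 2%:R * T1 n.-1 * N n.-1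
                 + (x - 1) * N n.-1 ^+ 2
        & N n = 2%:R * T1 n.-1 * N n.-1 + (x - 1) * N n.-1 ^+ 2]].
Proof.
(* [N] is known only through [T2E], and [S1_glue] carries a factor [x - 1]; the identities for [N]
   and the recursion for [T1] are therefore proved after multiplication by [x - 1], then
   cancelled. *)
have inj := mulfI subx1_neq0.
split; first exact: S1_edge_graph.
  by apply: inj; rewrite -T2E mulr1; apply: S2_edge_graph.
case=> // n _ /=.
have full : same_comp setT (specX (farey n)) (specY (farey n)).
  exact/connect1/farey_special_adj.
have E1 : (x - 1) * T1 n.+1 = (x - 1) * y * (T1 n * T1 n)
    + T1 n * T2 n + T2 n * T1 n + T2 n * T2 n := S1_glue full full.
have E2 : T2 n.+1 = T1 n * T2 n + T2 n * T1 n + T2 n * T2 n := S2_glue full full.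
rewrite !T2E in E1 E2.
split; first by rewrite -T2E; apply: (tutte_split (farey n.+1)).
- by apply: inj; rewrite E1; ring.
- by apply: inj; rewrite E2; ring.
Qed.
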